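(* Let $G$ be a finite simple graph without isolated vertices and fix a monomial order on the monomials in the variables $t_e$, $e\in E_G$. Then there exists a set of monomials in the variables $t_e$, $e\in E_G$, which, for every field $K$, generates the initial ideal (with respect to the fixed monomial order) of the ideal $I(X_G)\subseteq K[E_G]$. Moreover, there exists a set of polynomials with integer coefficients in the variables $t_e$, $e\in E_G$, whose image in $K[E_G]$ is, for every field $K$ of characteristic different from $2$, a Gröbner basis of $I(X_G)\subseteq K[E_G]$ with respect to the fixed monomial order.
   Context: Graphs have nonempty vertex set. For a field $K$ and a graph $G$ with vertex set $V_G$ and edge set $E_G$, let $K[V_G]=K[x_i: i\in V_G]$ and $K[E_G]=K[t_e: e\in E_G]$ be standard graded polynomial rings, and let $\theta\colon K[E_G]\to K[V_G]$ be the $K$-algebra homomorphism with $\theta(t_e)=x_ix_j$ for each edge $e=\{i,j\}$. The ideal $I(X_G)\subseteq K[E_G]$ is the (homogeneous) ideal $I(X_G)=\theta^{-1}\big((x_i^2-x_j^2 : i,j\in V_G)\big)$. *)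

(* Defs.v *)
From HB Require Import structures.
From mathcomp Require Export all_boot all_algebra.
From mathcomp Require Export mpoly.

Set Implicit Arguments.
Unset Strict Implicit.
Unset Printing Implicit Defensive.

Import GRing.Theory.
Local Open Scope ring_scope.

Definition simple_graph (V : finType) (adj : rel V) : Prop :=
  ssrbool.symmetric adj /\ irreflexive adj.

Definition no_isolated_vertex (V : finType) (adj : rel V) : Prop :=
  forall i : V, exists j : V, adj i j.

Definition edges (V : finType) (adj : rel V) : {set {set V}} :=
  [set [set ij.1; ij.2] | ij in [pred ij : V * V | adj ij.1 ij.2]].

(* K[V_G] is {mpoly K[#|V|]}, with x_i the variable 'X_(enum_rank i), and
   K[E_G] is {mpoly K[#|edges adj|]}, whose k-th variable is t_e for
   e = enum_val k. *)
Definition vvar (K : comNzRingType) (V : finType) (i : V) : {mpoly K[#|V|]} :=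
  'X_(enum_rank i).

Definition theta (K : comNzRingType) (V : finType) (adj : rel V)
    (f : {mpoly K[#|edges adj|]}) : {mpoly K[#|V|]} :=
  f \mPo [tuple \prod_(i in enum_val k) vvar K i | k < #|edges adj|].

Lemma theta_edge (K : comNzRingType) (V : finType) (adj : rel V)
    (k : 'I_#|edges adj|) (i j : V) :
  i != j -> enum_val k = [set i; j] ->
  theta ('X_k : {mpoly K[#|edges adj|]}) = vvar K i * vvar K j.
Proof.
move=> ij ke; rewrite /theta comp_mpolyXU -tnth_nth tnth_mktuple ke.
by rewrite big_setU1 ?inE //= big_set1.
Qed.

Definition ideal_gen (R : comNzRingType) (S : R -> Prop) (f : R) : Prop :=
  exists2 s : seq (R * R),
    (forall cg, cg \in s -> S cg.2) & f = \sum_(cg <- s) cg.1 * cg.2.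

Definition squares_ideal (K : fieldType) (V : finType) :
    {mpoly K[#|V|]} -> Prop :=
  ideal_gen (fun g => exists i j : V, g = vvar K i ^+ 2 - vvar K j ^+ 2).

Definition ideal_X (K : fieldType) (V : finType) (adj : rel V)
    (f : {mpoly K[#|edges adj|]}) : Prop :=
  squares_ideal (theta f).

(* Exponent vectors are written additively: the product of monomials is
   (m1 + m2)%MM and the monomial 1 is 0%MM. *)
Definition monomial_order (n : nat) (le : rel 'X_{1..n}) : Prop :=
  [/\ reflexive le, antisymmetric le, transitive le & total le] /\
  (forall m : 'X_{1..n}, le 0%MM m) /\
  (forall m m1 m2 : 'X_{1..n}, le m1 m2 -> le (m + m1)%MM (m + m2)%MM).

(* No m satisfies this when f = 0. *)
Definition is_lead_mon (n : nat) (K : fieldType) (le : rel 'X_{1..n})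
    (f : {mpoly K[n]}) (m : 'X_{1..n}) : Prop :=
  m \in msupp f /\ (forall m' : 'X_{1..n}, m' \in msupp f -> le m' m).

Definition lead_mons (n : nat) (K : fieldType) (le : rel 'X_{1..n})
    (F : {mpoly K[n]} -> Prop) (m : 'X_{1..n}) : Prop :=
  exists2 f : {mpoly K[n]}, F f & is_lead_mon le f m.

Definition monomial_ideal (n : nat) (K : fieldType) (M : 'X_{1..n} -> Prop) :
    {mpoly K[n]} -> Prop :=
  ideal_gen (fun g => exists2 m : 'X_{1..n}, M m & g = 'X_[m]).

Definition initial_ideal (n : nat) (K : fieldType) (le : rel 'X_{1..n})
    (I : {mpoly K[n]} -> Prop) : {mpoly K[n]} -> Prop :=
  monomial_ideal (lead_mons le I).

Definition groebner_basis (n : nat) (K : fieldType) (le : rel 'X_{1..n})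
    (I : {mpoly K[n]} -> Prop) (B : seq {mpoly K[n]}) : Prop :=
  (forall g, g \in B -> g != 0 /\ I g) /\
  (forall f, initial_ideal le I f <->
             monomial_ideal (lead_mons le (fun g => g \in B)) f).

(* Main.v *)
(* Over any field, f lies in (x_i^2 - x_j^2) iff its coefficients sum to zero
   over each class of monomials with the same degree and the same exponent
   parities. Hence I(X_G) is spanned by the binomials t^m - t^m' for which
   theta(t^m) and theta(t^m') lie in the same class, and t^m is a leading
   monomial of I(X_G) iff its class contains a smaller monomial, which does not
   involve the field. The monomials with this property are generated by those
   of degree at most |E| + 2, so finitely many binomials form a Groebner basis. *)

Require Import Defs.
From mathcomp Require Import all_boot all_algebra.
From mathcomp Require Import mpoly.
From mathcomp Require Import zify.

Set Implicit Arguments.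
Unset Strict Implicit.
Unset Printing Implicit Defensive.

Import GRing.Theory.
Local Open Scope ring_scope.

(** * Generated ideals and congruence modulo them *)

Lemma ideal_gen0 (R : comNzRingType) (S : R -> Prop) : ideal_gen S 0.
Proof. by exists [::] => //; rewrite big_nil. Qed.

Lemma ideal_genD (R : comNzRingType) (S : R -> Prop) (f g : R) :
  ideal_gen S f -> ideal_gen S g -> ideal_gen S (f + g).
Proof.
move=> [s Ss ->] [t St ->]; exists (s ++ t); last by rewrite big_cat.
by move=> cg; rewrite mem_cat => /orP[/Ss|/St].
Qed.

Lemma ideal_genM (R : comNzRingType) (S : R -> Prop) (c f : R) :
  ideal_gen S f -> ideal_gen S (c * f).
Proof.
move=> [s Ss ->]; exists [seq (c * cg.1, cg.2) | cg <- s].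
  by move=> _ /mapP[cg /Ss Scg ->].
by rewrite big_map mulr_sumr; apply: eq_bigr => cg _; rewrite mulrA.
Qed.

Lemma ideal_genN (R : comNzRingType) (S : R -> Prop) (f : R) :
  ideal_gen S f -> ideal_gen S (- f).
Proof. by rewrite -mulN1r; exact: ideal_genM. Qed.

Lemma ideal_gen_mem (R : comNzRingType) (S : R -> Prop) (g : R) :
  S g -> ideal_gen S g.
Proof.
move=> Sg; exists [:: (1, g)]; last by rewrite big_seq1 mul1r.
by move=> cg; rewrite inE => /eqP->.
Qed.

Lemma ideal_gen_sub (R : comNzRingType) (S T : R -> Prop) (f : R) :
  (forall g, S g -> ideal_gen T g) -> ideal_gen S f -> ideal_gen T f.
Proof.
move=> ST [s Ss ->]; rewrite big_seq.
apply: big_ind => [|g h|cg /Ss /ST]; first exact: ideal_gen0.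
  exact: ideal_genD.
exact: ideal_genM.
Qed.

Lemma ideal_gen_congrM (R : comNzRingType) (S : R -> Prop) (f1 g1 f2 g2 : R) :
  ideal_gen S (f1 - g1) -> ideal_gen S (f2 - g2) ->
  ideal_gen S (f1 * f2 - g1 * g2).
Proof.
move=> S1 S2; have -> : f1 * f2 - g1 * g2 = f2 * (f1 - g1) + g1 * (f2 - g2).
  by rewrite !mulrBr addrA mulrC [f2 * g1]mulrC subrK.
by apply: ideal_genD; apply: ideal_genM.
Qed.

(** The shared term [g] stands second in both differences, so that two polynomials can be compared
    through a common normal form. *)
Lemma ideal_gen_congr_trans (R : comNzRingType) (S : R -> Prop) (f g h : R) :
  ideal_gen S (f - g) -> ideal_gen S (h - g) -> ideal_gen S (f - h).
Proof.
move=> Sfg /ideal_genN Shg; have -> : f - h = (f - g) + - (h - g).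
  by rewrite opprB addrA subrK.
exact: ideal_genD.
Qed.

Lemma ideal_gen_congr_prod (R : comNzRingType) (S : R -> Prop) (I : finType)
    (f g : I -> R) :
  (forall i, ideal_gen S (f i - g i)) ->
  ideal_gen S (\prod_i f i - \prod_i g i).
Proof.
move=> Sfg; apply: (big_ind2 (fun x y => ideal_gen S (x - y))) => //.
  by rewrite subrr; exact: ideal_gen0.
by move=> *; exact: ideal_gen_congrM.
Qed.

Lemma ideal_gen_congrX (R : comNzRingType) (S : R -> Prop) (f g : R) k :
  ideal_gen S (f - g) -> ideal_gen S (f ^+ k - g ^+ k).
Proof.
move=> Sfg; elim: k => [|k IHk]; first by rewrite !expr0 subrr; exact: ideal_gen0.
by rewrite !exprS; exact: ideal_gen_congrM.
Qed.

(** * Classes of monomials modulo the differences of squares *)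

Definition same_parity n (a b : 'X_{1..n}) : bool :=
  (mdeg a == mdeg b) && [forall i, odd (a i) == odd (b i)].

Lemma same_parityP n (a b : 'X_{1..n}) :
  reflect (mdeg a = mdeg b /\ forall i, odd (a i) = odd (b i))
          (same_parity a b).
Proof.
apply: (iffP andP) => -[].
  by move=> /eqP dab /forallP oab; split=> // i; apply/eqP.
by move=> dab oab; split; [apply/eqP | apply/forallP => i; apply/eqP].
Qed.

Lemma same_parity_refl n : reflexive (@same_parity n).
Proof. by move=> a; apply/same_parityP. Qed.

Lemma same_parityC n (a b : 'X_{1..n}) : same_parity a b = same_parity b a.
Proof.
by apply/same_parityP/same_parityP => -[dab oab]; split=> // i; rewrite oab.
Qed.

Lemma same_parity_trans n : transitive (@same_parity n).
Proof.
move=> b a c /same_parityP[dab oab] /same_parityP[dbc obc].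
by apply/same_parityP; split=> [|i]; rewrite ?dab ?oab.
Qed.

Lemma same_parityD2l n (c a b : 'X_{1..n}) :
  same_parity (c + a)%MM (c + b)%MM = same_parity a b.
Proof.
apply/same_parityP/same_parityP; rewrite !mdegD => -[dab oab].
  split=> [|i]; first exact: addnI dab.
  by have := oab i; rewrite !mnmDE !oddD => /addbI.
by split=> [|i]; rewrite ?dab // !mnmDE !oddD oab.
Qed.

(* Modulo the ideal, x^a depends only on the parities of the a_i and on the
   total degree: all squares x_i^2 become equal to a single one. *)
Lemma squares_ideal_same_parity (K : fieldType) (V : finType) (v0 : V)
    (a b : 'X_{1..#|V|}) :
  same_parity a b -> squares_ideal ('X_[K, a] - 'X_[b]).
Proof.
pose y := vvar K v0 ^+ 2.
pose p (c : 'X_{1..#|V|}) : {mpoly K[#|V|]} := \prod_i 'X_i ^+ odd (c i).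
have nf c : squares_ideal ('X_[K, c] - p c * y ^+ (\sum_i (c i)./2)).
  rewrite mpolyXE_id -prodrXr -big_split /=; apply: ideal_gen_congr_prod => i.
  rewrite -{1}[c i]odd_double_half exprD; apply: ideal_gen_congrM.
    by rewrite subrr; exact: ideal_gen0.
  rewrite -mul2n exprM; apply: ideal_gen_congrX; apply: ideal_gen_mem.
  by exists (enum_val i), v0; rewrite /vvar enum_valK.
move=> /same_parityP[dab oab]; apply: ideal_gen_congr_trans (nf a) _.
have -> : p a = p b by apply: eq_bigr => i _; rewrite oab.
suff -> : (\sum_i (a i)./2 = \sum_i (b i)./2)%N by exact: nf.
(* Twice the halves plus the parities give back the exponents, so both sides become total
   degrees. *)
apply: double_inj; apply: (@addnI (\sum_i odd (a i))%N).
rewrite {2}(eq_bigr _ (fun i _ => congr1 nat_of_bool (oab i))).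
rewrite -!mul2n !big_distrr -!big_split /=.
under eq_bigr do rewrite mul2n odd_double_half.
under [RHS]eq_bigr do rewrite mul2n odd_double_half.
by rewrite -!mdegE.
Qed.

(** The degree bound only makes the index type finite: [same_parity m c] already forces the degree
    of [m] to be that of [c]. *)
Definition class_sum (K : fieldType) n (c : 'X_{1..n}) (f : {mpoly K[n]}) : K :=
  \sum_(m : 'X_{1..n < (mdeg c).+1} | same_parity m c) f@_m.

Lemma class_sum_sum (K : fieldType) n (c : 'X_{1..n}) (I : Type) (s : seq I)
    (F : I -> {mpoly K[n]}) :
  class_sum c (\sum_(i <- s) F i) = \sum_(i <- s) class_sum c (F i).
Proof.
by rewrite exchange_big /=; apply: eq_bigr => m _; rewrite raddf_sum.
Qed.

Lemma class_sumB (K : fieldType) n (c : 'X_{1..n}) (f g : {mpoly K[n]}) :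
  class_sum c (f - g) = class_sum c f - class_sum c g.
Proof. by rewrite /class_sum -sumrB; apply: eq_bigr => m _; rewrite mcoeffB. Qed.

Lemma class_sumZ (K : fieldType) n (c : 'X_{1..n}) (k : K) (f : {mpoly K[n]}) :
  class_sum c (k *: f) = k * class_sum c f.
Proof. by rewrite /class_sum mulr_sumr; apply: eq_bigr => m _; rewrite mcoeffZ. Qed.

Lemma class_sumX (K : fieldType) n (c a : 'X_{1..n}) :
  class_sum c 'X_[K, a] = (same_parity a c)%:R.
Proof.
rewrite /class_sum; under eq_bigr do rewrite mcoeffX.
case: (boolP (same_parity a c)) => [ac|nac].
  have da : (mdeg a < (mdeg c).+1)%N by case/same_parityP: ac => ->.
  rewrite (bigD1 (BMultinom da)) //= eqxx big1 ?addr0 // => m /andP[_ nm].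
  case: (a =P m) => // am.
  by rewrite bmeqP /= am eqxx in nm.
rewrite big1 // => m mc; case: eqP => // am.
by rewrite am mc in nac.
Qed.

(** A monomial times a generator is a difference of two monomials of one class, whose contributions
    cancel; linearity does the rest. *)
Lemma class_sum_squares_ideal (K : fieldType) (V : finType) (c : 'X_{1..#|V|})
    (f : {mpoly K[#|V|]}) :
  squares_ideal f -> class_sum c f = 0.
Proof.
move=> [s Ss ->]; rewrite class_sum_sum big_seq big1 // => -[g h] /Ss[i [j /= ->]].
rewrite {1}[g]mpolyE mulr_suml class_sum_sum big1 // => m _.
rewrite -scalerAl class_sumZ /vvar !mpolyXn mulrBr -!mpolyXD class_sumB !class_sumX.
suff e : same_parity (m + U_(enum_rank i) *+ 2)%MM (m + U_(enum_rank j) *+ 2)%MM.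
  have -> : same_parity (m + U_(enum_rank i) *+ 2)%MM c =
            same_parity (m + U_(enum_rank j) *+ 2)%MM c.
    apply/idP/idP; apply: same_parity_trans => //.
    by rewrite same_parityC.
  by rewrite subrr mulr0.
rewrite same_parityD2l; apply/same_parityP; split=> [|k].
  by rewrite !mdegMn !mdeg1.
by rewrite !mulmnE !muln2 !odd_double.
Qed.

(** * The map [theta] on monomials and the binomials of the ideal *)

Definition edge_mon (V : finType) (adj : rel V) (m : 'X_{1..#|edges adj|}) :
    'X_{1..#|V|} :=
  (\sum_(k < #|edges adj|) (\sum_(i in enum_val k) U_(enum_rank i)) *+ m k)%MM.

Lemma theta_mon (K : fieldType) (V : finType) (adj : rel V)
    (m : 'X_{1..#|edges adj|}) :
  theta 'X_[K, m] = 'X_[edge_mon m].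
Proof.
rewrite /theta comp_mpolyX /edge_mon -mprodXE; apply: eq_bigr => k _.
by rewrite tnth_mktuple /vvar mprodXE mpolyXn.
Qed.

Lemma edge_monD (V : finType) (adj : rel V) (m1 m2 : 'X_{1..#|edges adj|}) :
  edge_mon (m1 + m2)%MM = (edge_mon m1 + edge_mon m2)%MM.
Proof.
rewrite /edge_mon -big_split /=; apply: eq_bigr => k _.
by apply/mnmP => i; rewrite !(mnmDE, mulmnE) mulnDr.
Qed.

(** Without loops every edge has exactly two ends, so each variable contributes degree 2. *)
Lemma mdeg_edge_mon (V : finType) (adj : rel V) (m : 'X_{1..#|edges adj|}) :
  irreflexive adj -> mdeg (edge_mon m) = (mdeg m).*2.
Proof.
move=> irr; rewrite mdeg_sum mdegE -mul2n big_distrr /=; apply: eq_bigr => k _.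
rewrite mdegMn mdeg_sum (eq_bigr (fun=> 1%N)) => [|i _]; last exact: mdeg1.
rewrite sum1_card; congr (_ * _)%N.
have /imsetP[[i j] /= ij ->] : enum_val k \in edges adj by exact: enum_valP.
rewrite cards2; case: eqP ij => // ->.
by rewrite inE /= irr.
Qed.

Definition edge_equiv (V : finType) (adj : rel V) :
    rel 'X_{1..#|edges adj|} :=
  fun m m' => same_parity (edge_mon m) (edge_mon m').

Lemma edge_equivD2l (V : finType) (adj : rel V) (c m m' : 'X_{1..#|edges adj|}) :
  edge_equiv (c + m)%MM (c + m')%MM = edge_equiv m m'.
Proof. by rewrite /edge_equiv !edge_monD same_parityD2l. Qed.

Lemma edge_equiv_squares (V : finType) (adj : rel V) (k l : 'I_#|edges adj|) :
  irreflexive adj -> edge_equiv (U_(k) + U_(k))%MM (U_(l) + U_(l))%MM.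
Proof.
move=> irr; apply/same_parityP; split=> [|i].
  by rewrite !mdeg_edge_mon // !mdegD !mdeg1.
by rewrite !edge_monD !mnmDE !oddD !addbb.
Qed.

Lemma mdeg_edge_equiv (V : finType) (adj : rel V) (m m' : 'X_{1..#|edges adj|}) :
  irreflexive adj -> edge_equiv m m' -> mdeg m = mdeg m'.
Proof.
move=> irr /same_parityP[+ _]; rewrite !mdeg_edge_mon //; exact: double_inj.
Qed.

Lemma ideal_X_binomial (K : fieldType) (V : finType) (adj : rel V) (v0 : V)
    (m m' : 'X_{1..#|edges adj|}) :
  edge_equiv m m' -> ideal_X ('X_[K, m] - 'X_[m']).
Proof.
rewrite /ideal_X /theta comp_mpolyB -!/(theta _) !theta_mon.
exact: squares_ideal_same_parity.
Qed.

(** If [m] were alone in its class within the support, the class sum of [theta f] at [edge_mon m]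
    would be the nonzero coefficient of [m] in [f], yet it vanishes on the ideal. *)
Lemma ideal_X_supp (K : fieldType) (V : finType) (adj : rel V)
    (f : {mpoly K[#|edges adj|]}) (m : 'X_{1..#|edges adj|}) :
  ideal_X f -> m \in msupp f ->
  exists m', [/\ m' \in msupp f, m' != m & edge_equiv m m'].
Proof.
move=> /(class_sum_squares_ideal (edge_mon m)) sum0 mf.
have [/hasP[m' m'f /andP[nm mm']]|/hasPn no_other] :=
    boolP (has (fun m' => (m' != m) && edge_equiv m m') (msupp f)).
  by exists m'.
have := mf; rewrite mcoeff_msupp => /eqP[]; rewrite -{}sum0.
rewrite /theta comp_mpolyEX class_sum_sum (bigD1_seq m) ?msupp_uniq //=.
rewrite class_sumZ -/(theta _) theta_mon class_sumX same_parity_refl mulr1.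
rewrite big_seq_cond big1 ?addr0 // => m' /andP[/no_other].
rewrite negb_and => /orP[/negPn/eqP-> | nmm' _]; first by rewrite eqxx.
rewrite class_sumZ -/(theta _) theta_mon class_sumX same_parityC.
by move: nmm'; rewrite /edge_equiv => /negPf->; rewrite mulr0.
Qed.

(** * Leading monomials, described without the field *)

Definition reducible_mon (V : finType) (adj : rel V)
    (le : rel 'X_{1..#|edges adj|}) (m : 'X_{1..#|edges adj|}) : Prop :=
  exists m', [/\ edge_equiv m m', m' != m & le m' m].

Lemma is_lead_mon_binomial (K : fieldType) n (le : rel 'X_{1..n})
    (m m' : 'X_{1..n}) :
  monomial_order le -> m' != m -> le m' m ->
  is_lead_mon le ('X_[K, m] - 'X_[m']) m.
Proof.
move=> [[le_refl _ _ _] _] nm lm'm; split=> [|m1].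
  by rewrite mcoeff_msupp mcoeffB !mcoeffX eqxx (negPf nm) subr0 oner_eq0.
rewrite mcoeff_msupp mcoeffB !mcoeffX.
have [<- // | _] := eqVneq m m1; have [<- // | _] := eqVneq m' m1.
by rewrite subrr eqxx.
Qed.

Lemma lead_mons_ideal_X (K : fieldType) (V : finType) (adj : rel V) (v0 : V)
    (le : rel 'X_{1..#|edges adj|}) (m : 'X_{1..#|edges adj|}) :
  monomial_order le ->
  lead_mons le (@ideal_X K V adj) m <-> reducible_mon le m.
Proof.
move=> mo; split=> [[f If [mf lead_m]]|[m' [mm' nm lm'm]]].
  have [m' [m'f nm mm']] := ideal_X_supp If mf.
  by exists m'; split=> //; exact: lead_m.
exists ('X_[m] - 'X_[m']); first exact: ideal_X_binomial.
exact: is_lead_mon_binomial.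
Qed.

(** By totality the only other case is that [m'] is at most [m]; then the two products bound each
    other, hence coincide, and so do [m] and [m']. *)
Lemma monomial_order_cancel n (le : rel 'X_{1..n}) (c m m' : 'X_{1..n}) :
  monomial_order le -> le (c + m)%MM (c + m')%MM -> le m m'.
Proof.
move=> [[le_refl le_anti _ le_tot] [_ leD]] lcm.
have /orP[//|lm'm] := le_tot m m'.
suff -> : m = m' by exact: le_refl.
by apply: (@addmI _ c); apply: le_anti; rewrite lcm leD.
Qed.

(** A squarefree monomial in [n] variables has degree at most [n]. *)
Lemma mdeg_gt_square n (m : 'X_{1..n}) :
  (n < mdeg m)%N -> exists k m0, m = (U_(k) + (U_(k) + m0))%MM.
Proof.
move=> lt_n_m; have [k lt1mk|le_m1] := pickP (fun k => 1 < m k)%N.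
  exists k, (m - (U_(k) + U_(k)))%MM; apply/mnmP => i.
  rewrite !mnmDE mnmBE mnmDE mnm1E; case: eqP => [<-|_] /=; lia.
suff : (mdeg m <= n)%N by rewrite leqNgt lt_n_m.
rewrite mdegE -[n in leqRHS]card_ord -sum1_card; apply: leq_sum => k _.
by have := le_m1 k; rewrite ltnNge => /negbFE.
Qed.

(* A reducible m of degree > |E| and its smaller equivalent m' are divisible by
   squares t_k^2 and t_l^2. If t_l < t_k then t_k^2 is itself reducible;
   otherwise trading t_l^2 for t_k^2 in m' does not increase the witness,
   which then shares the factor t_k with m. *)
Lemma reducible_mon_small_divisor (V : finType) (adj : rel V)
    (le : rel 'X_{1..#|edges adj|}) (m : 'X_{1..#|edges adj|}) :
  irreflexive adj -> monomial_order le -> reducible_mon le m ->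
  exists m1 c, [/\ m = (c + m1)%MM, reducible_mon le m1
                 & (mdeg m1 < #|edges adj| + 3)%N].
Proof.
move=> irr mo; have [[le_refl le_anti le_trans le_tot] [_ leD]] := mo.
have [d] := ubnP (mdeg m); elim: d m => // d IHd m dm red_m.
have [small|big] := ltnP (mdeg m) (#|edges adj| + 3)%N.
  by exists m, 0%MM; rewrite add0m.
have [m' [mm' nm lm'm]] := red_m.
have [|k [m0 em]] := @mdeg_gt_square _ m; first lia.
have [|l [m0' em']] := @mdeg_gt_square _ m'.
  by rewrite -(mdeg_edge_equiv irr mm'); lia.
have [lkl|nlkl] := boolP (le U_(k)%MM U_(l)%MM); last first.
  have llk : le U_(l)%MM U_(k)%MM.
    by have := le_tot U_(k)%MM U_(l)%MM; rewrite (negPf nlkl).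
  have nkl : U_(l)%MM != U_(k)%MM :> 'X_{1..#|edges adj|}.
    by apply: contra nlkl => /eqP->; exact: le_refl.
  have l2k2 : le (U_(l) + U_(l))%MM (U_(k) + U_(k))%MM.
    apply: le_trans (leD _ _ _ llk) _; rewrite addmC; exact: leD.
  (* The divisor is t_k^2, with witness t_l^2. Its degree 2 is below the bound for any number of
     edges. *)
  exists (U_(k) + U_(k))%MM, m0; split; first by rewrite addmC -addmA.
    exists (U_(l) + U_(l))%MM; split=> //; first exact: edge_equiv_squares.
    apply: contra nkl => /eqP/mnmP/(_ k); rewrite !mnmDE !mnm1E eqxx eq_mnm1.
    by case: (l == k).
  by rewrite mdegD !mdeg1; lia.
pose w := (U_(k) + m0')%MM.
(* Replace the two factors t_l of [m'] by t_k one at a time. *)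
have lw : le (U_(k) + w)%MM m'.
  rewrite em' /w; apply: (@le_trans (U_(l) + (U_(k) + m0'))%MM).
    by rewrite ![(_ + (U_(k) + m0'))%MM]addmC; exact: leD.
  apply: (leD U_(l)%MM); rewrite ![(_ + m0')%MM]addmC; exact: leD.
have ww : edge_equiv m' (U_(k) + w)%MM.
  rewrite em' /w !addmA ![(_ + _ + m0')%MM]addmC edge_equivD2l.
  exact: edge_equiv_squares.
(* Divide [m] and t_k [w] by their common factor t_k. If the quotients were equal, then [m] = t_k
   [w] would be at most [m'], forcing [m'] = [m]. *)
have red : reducible_mon le (U_(k) + m0)%MM.
  exists w; split.
  - by rewrite -(edge_equivD2l U_(k)) -em; exact: same_parity_trans mm' ww.
  - apply/eqP => ew; case/eqP: nm; apply: le_anti; rewrite lm'm em -ew.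
    exact: lw.
  - apply: (@monomial_order_cancel _ _ U_(k)%MM) => //; rewrite -em.
    exact: le_trans lw lm'm.
have [|m1 [c [ec red1 d1]]] := IHd (U_(k) + m0)%MM _ red.
  by move: dm; rewrite em mdegD mdeg1.
by exists m1, (U_(k) + c)%MM; rewrite em ec addmA.
Qed.

(** * The finite Gröbner basis with integer coefficients *)

Lemma monomial_ideal_sub (K : fieldType) n (M N : 'X_{1..n} -> Prop)
    (f : {mpoly K[n]}) :
  (forall m, M m -> exists m1 c, m = (c + m1)%MM /\ N m1) ->
  monomial_ideal M f -> monomial_ideal N f.
Proof.
move=> MN; apply: ideal_gen_sub => _ [m /MN[m1 [c [-> Nm1]]] ->].
by rewrite mpolyXD; apply/ideal_genM/ideal_gen_mem; exists m1.
Qed.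

(** Bounded monomials form a finite type, so the binomials can be listed. The coefficients 1 and -1
    keep [mm.1] the leading monomial over every field. *)
Definition small_binomials (V : finType) (adj : rel V)
    (le : rel 'X_{1..#|edges adj|}) : seq {mpoly int[#|edges adj|]} :=
  let mon := 'X_{1..#|edges adj| < #|edges adj| + 3} in
  [seq 'X_[mm.1] - 'X_[mm.2]
  | mm : mon * mon in [pred mm : mon * mon
          | [&& edge_equiv mm.1 mm.2, mm.2 != mm.1 :> 'X_{1..#|edges adj|}
              & le mm.2 mm.1]]].

Lemma small_binomialsP (K : fieldType) (V : finType) (adj : rel V)
    (le : rel 'X_{1..#|edges adj|}) (g : {mpoly K[#|edges adj|]}) :
  g \in [seq map_mpoly (intr : int -> K) g | g <- small_binomials le] <->
  exists m m', [/\ g = 'X_[m] - 'X_[m'],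
    [/\ edge_equiv m m', m' != m & le m' m],
    (mdeg m < #|edges adj| + 3)%N & (mdeg m' < #|edges adj| + 3)%N].
Proof.
split=> [/mapP[_ /imageP[[m m'] /and3P[mm' nm lm'm] ->] ->]|].
  exists m, m'; split=> //; rewrite ?bmdeg //.
  by rewrite rmorphB /= !map_mpolyX.
move=> [m [m' [-> [mm' nm lm'm] dm dm']]].
apply/mapP; exists ('X_[m] - 'X_[m']); last by rewrite rmorphB /= !map_mpolyX.
by apply/imageP; exists (BMultinom dm, BMultinom dm') => //; apply/and3P.
Qed.

Theorem proposition2p8 (V : finType) (adj : rel V)
    (V_nonempty : (0 < #|V|)%N)
    (G_simple : simple_graph adj)
    (G_no_isolated : no_isolated_vertex adj)
    (le : rel 'X_{1..#|edges adj|})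
    (le_monomial_order : monomial_order le) :
  (exists M : 'X_{1..#|edges adj|} -> Prop,
     forall (K : fieldType) (f : {mpoly K[#|edges adj|]}),
       initial_ideal le (@ideal_X K V adj) f <-> monomial_ideal M f)
  /\
  (exists B : seq {mpoly int[#|edges adj|]},
     forall K : fieldType, 2%N \notin [pchar K]%R ->
       groebner_basis le (@ideal_X K V adj)
         [seq map_mpoly (intr : int -> K) g | g <- B]).
Proof.
have mo := le_monomial_order; have [_ irr] := G_simple.
have [v0 _] := card_gt0P V_nonempty.
have leadP K m := @lead_mons_ideal_X K V adj v0 le m mo.
split.
  exists (reducible_mon le) => K f.
  by split; apply: monomial_ideal_sub => m /leadP red_m;
     exists m, 0%MM; rewrite add0m.
exists (small_binomials le) => K _; split.
  move=> g /small_binomialsP[m [m' [-> [mm' nm lm'm] _ _]]].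
  split; last exact: ideal_X_binomial.
  rewrite subr_eq0; apply: contra nm => /eqP/(congr1 (mcoeff m)).
  rewrite !mcoeffX eqxx; case: (m' == m) => // /eqP.
  by rewrite oner_eq0.
move=> f; split; apply: monomial_ideal_sub => m.
  (* A leading monomial has a reducible divisor [m1] of small degree; the witness [m'] for [m1] has
     the same degree, so their binomial is in the list. *)
  move=> /leadP /(reducible_mon_small_divisor irr mo).
  move=> [m1 [c [-> [m' [mm' nm lm'm]] dm1]]].
  exists m1, c; split=> //; exists ('X_[m1] - 'X_[m']).
    apply/small_binomialsP; exists m1, m'; split=> //.
    by rewrite -(mdeg_edge_equiv irr mm').
  exact: is_lead_mon_binomial.
(* Conversely, each listed binomial lies in the ideal, so its leading monomial is already one of the
   ideal's. *)
move=> [g /small_binomialsP[m1 [m' [-> [mm' nm lm'm] _ _]]] lead_m].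
exists m, 0%MM; rewrite add0m; split=> //.
by exists ('X_[m1] - 'X_[m']); first exact: ideal_X_binomial.
Qed.
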